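(* For all parameters $a,b,c,d,f,g,h,\ell,p,r,s,t,u,w$, one has, as formal power series in $z$, $$\mathcal C(z)=\sum_{n\ge 0}\sum_{\sigma\in\mathcal S_n} a^{\mathsf{ile}(\sigma)} b^{\mathsf{nile}(\sigma)} c^{\mathsf{ie}(\sigma)-\mathsf{ile}(\sigma)} d^{\mathsf{nie}(\sigma)-\mathsf{nile}(\sigma)} f^{\mathsf{ilae}(\sigma)} g^{\mathsf{nilae}(\sigma)} h^{\mathsf{iae}(\sigma)-\mathsf{ilae}(\sigma)} \ell^{\mathsf{niae}(\sigma)-\mathsf{nilae}(\sigma)}\, p^{\mathsf{exc}(\sigma)-\mathsf{le}(\sigma)} r^{\mathsf{aexc}(\sigma)-\mathsf{lae}(\sigma)} s^{\mathsf{le}(\sigma)} t^{\mathsf{lae}(\sigma)} u^{\mathsf{fp}(\sigma)} w^{\mathsf{iefp}(\sigma)} z^n .$$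
   Context: $[n]=\{1,\dots,n\}$ and $\mathcal S_n$ is the set of permutations of $[n]$ ($\mathcal S_0$ consists of the empty permutation). For $n\ge1$, $[n]_{x,y}:=\sum_{i=0}^{n-1}x^{n-1-i}y^{i}$, and $[0]_{x,y}:=0$; the convention $0^0=1$ is used. For real parameters $a,b,c,d,f,g,h,\ell,p,r,s,t,u,w$ (they may equally be regarded as indeterminates), $\mathcal C(z)=\mathcal C_{a,b,c,d,f,g,h,\ell,p,r,s,t,u,w}(z)$ is the formal power series in $z$ defined by the continued fraction $$\mathcal C(z)=\cfrac{1}{1-\alpha_0z-\cfrac{\beta_1z^2}{1-\alpha_1z-\cfrac{\beta_2z^2}{\ddots}}},\qquad \alpha_n=u\,w^n+s\,[n]_{a,b}+t\,[n]_{f,g}\ (n\ge 0),\quad \beta_n=p\,r\,[n]_{c,d}\,[n]_{h,\ell}\ (n\ge 1).$$ For $\sigma\in\mathcal S_n$ define (indices $i$, and ordered pairs $(i,j)$, range over $[n]$): - $\mathsf{exc}(\sigma)=\#\{i: i<\sigma(i)\}$, $\mathsf{fp}(\sigma)=\#\{i:i=\sigma(i)\}$, $\mathsf{aexc}(\sigma)=\#\{i: i>\sigma(i)\}$; - $\mathsf{le}(\sigma)=\#\{i:\sigma^{-1}(i)<i<\sigma(i)\}$, $\mathsf{lae}(\sigma)=\#\{i:\sigma^{-1}(i)>i>\sigma(i)\}$; - $\mathsf{ie}(\sigma)=\#\{(i,j): i<j<\sigma(j)<\sigma(i)\}$, $\mathsf{ile}(\sigma)=\#\{(i,j): i<j<\sigma(j)<\sigma(i),\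 \sigma^{-1}(j)<j\}$; - $\mathsf{nie}(\sigma)=\#\{(i,j): i<j<\sigma(i)<\sigma(j)\}$, $\mathsf{nile}(\sigma)=\#\{(i,j): i<j<\sigma(i)<\sigma(j),\ \sigma^{-1}(j)<j\}$; - $\mathsf{iae}(\sigma)=\#\{(i,j): j>i>\sigma(i)>\sigma(j)\}$, $\mathsf{ilae}(\sigma)=\#\{(i,j): j>i>\sigma(i)>\sigma(j),\ \sigma^{-1}(i)>i\}$; - $\mathsf{niae}(\sigma)=\#\{(i,j): j>i>\sigma(j)>\sigma(i)\}$, $\mathsf{nilae}(\sigma)=\#\{(i,j): j>i>\sigma(j)>\sigma(i),\ \sigma^{-1}(i)>i\}$; - $\mathsf{iefp}(\sigma)=\#\{(i,j): i<j=\sigma(j)<\sigma(i)\}$. *)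

(* Defs.v *)
From HB Require Import structures.
From mathcomp Require Import all_boot all_order all_algebra all_fingroup.

Set Implicit Arguments.
Unset Strict Implicit.
Unset Printing Implicit Defensive.

Import GRing.Theory.
Local Open Scope ring_scope.

(* A formal power series is its coefficient sequence: [F m] is the coefficient
   of z ^ m. Series are compared coefficientwise, with [=1]. *)
Definition fps (R : Type) : Type := nat -> R.

Section FormalPowerSeries.
Variable R : comNzRingType.
Implicit Types F G H : fps R.

Definition fps_one : fps R := fun m => (m == 0%N)%:R.

Definition fps_mul F G : fps R := fun m => \sum_(i < m.+1) F i * G (m - i)%N.

Fixpoint fps_exp H (k : nat) : fps R :=
  if k is k'.+1 then fps_mul H (fps_exp H k') else fps_one.

(* The series 1 / (1 - H), for H without constant term, as the sum of the
   powers of H; the powers beyond the m-th do not contribute to z ^ m. *)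
Definition fps_inv1B H : fps R := fun m => \sum_(k < m.+1) fps_exp H k m.

(* The series a z + b z^2 F. *)
Definition fps_quad (a b : R) F : fps R := fun m =>
  match m with
  | 0 => 0
  | 1 => a
  | m'.+2 => b * F m'
  end.

Lemma eq_fps_mul F F' G G' m :
    (forall i, (i <= m)%N -> F i = F' i) ->
    (forall i, (i <= m)%N -> G i = G' i) ->
  fps_mul F G m = fps_mul F' G' m.
Proof.
move=> eqF eqG; apply: eq_bigr => i _.
by rewrite eqF ?eqG ?leq_subr // -ltnS.
Qed.

Lemma eq_fps_exp H H' k m :
  (forall i, (i <= m)%N -> H i = H' i) -> fps_exp H k m = fps_exp H' k m.
Proof.
elim: k m => [|k IHk] m eqH //=.
apply: eq_fps_mul => // i le_im.
by apply: IHk => j le_ji; apply/eqH/(leq_trans le_ji).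
Qed.

Lemma eq_fps_inv1B H H' m :
  (forall i, (i <= m)%N -> H i = H' i) -> fps_inv1B H m = fps_inv1B H' m.
Proof. by move=> eqH; apply: eq_bigr => k _; apply: eq_fps_exp. Qed.

Lemma fps_exp_small H k m : H 0 = 0 -> (m < k)%N -> fps_exp H k m = 0.
Proof.
move=> H0; elim: k m => [|k IHk] m //= lt_mk.
apply: big1 => -[[|i] ilt] _ /=; first by rewrite H0 mul0r.
by rewrite IHk ?mulr0 //; move: ilt lt_mk; case: m => // m _; rewrite subSS => ?;
   apply: leq_ltn_trans (leq_subr _ _) _.
Qed.

Lemma fps_inv1BP H : H 0 = 0 ->
  fps_mul (fun m => fps_one m - H m) (fps_inv1B H) =1 fps_one.
Proof.
move=> H0 m; rewrite /fps_mul.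
under eq_bigr do rewrite mulrBl.
rewrite sumrB big_ord_recl /= subn0 mul1r big1 ?addr0 => [|i _]; last first.
  by rewrite /fps_one /= mul0r.
have ->: \sum_(i < m.+1) H i * fps_inv1B H (m - i)%N
         = \sum_(k < m.+1) fps_exp H k.+1 m.
  rewrite /= /fps_mul exchange_big; apply: eq_bigr => i _ /=.
  rewrite -mulr_sumr; congr (_ * _).
  have le1 : ((m - i).+1 <= m.+1)%N by rewrite ltnS leq_subr.
  rewrite /fps_inv1B (big_ord_widen _ (fun k => fps_exp H k (m - i)%N) le1).
  rewrite big_mkcond; apply: eq_bigr => k _.
  by case: ltnP => // lt_k; rewrite fps_exp_small.
have := erefl (\sum_(k < m.+2) fps_exp H k m).
rewrite [RHS]big_ord_recr (fps_exp_small H0 (ltnSn m)) /= addr0.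
rewrite big_ord_recl => /= telescope.
by rewrite /fps_inv1B -telescope addrK.
Qed.

Section JFraction.
Variables alpha beta : nat -> R.

(* The N-th convergent of the tail
     1 / (1 - alpha_k z - beta_(k+1) z^2 / (1 - alpha_(k+1) z - ...)):
   the fraction is cut after N denominators. *)
Fixpoint jconv (N k : nat) : fps R :=
  if N is N'.+1
  then fps_inv1B (fps_quad (alpha k) (beta k.+1) (jconv N' k.+1))
  else fun _ => 0.

(* The z-adic limit of the convergents; see [jfrac_cvg]. *)
Definition jfrac : fps R := fun m => jconv m.+1 0 m.

Lemma jconv_stable N N' k m :
  (m < N)%N -> (N <= N')%N -> jconv N k m = jconv N' k m.
Proof.
elim: N N' k m => // N IHN [|N'] // k m lt_mN le_NN' /=.
apply: eq_fps_inv1B => -[|[|i]] //= le_im; congr (_ * _).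
by apply: IHN => //; apply: leq_trans (ltnW le_im) lt_mN.
Qed.

Lemma jfrac_cvg m N : (m < N)%N -> jconv N 0 m = jfrac m.
Proof. by move=> lt_mN; rewrite [RHS](jconv_stable _ _ lt_mN). Qed.

End JFraction.

(* [n]_(x, y); the sum is empty for n = 0. *)
Definition qbracket (n : nat) (x y : R) : R :=
  \sum_(i < n) x ^+ (n - 1 - i) * y ^+ i.

Definition C_alpha (a b f g s t u w : R) (n : nat) : R :=
  u * w ^+ n + s * qbracket n a b + t * qbracket n f g.

Definition C_beta (c d h l p r : R) (n : nat) : R :=
  p * r * qbracket n c d * qbracket n h l.

Definition C_series (a b c d f g h l p r s t u w : R) : fps R :=
  jfrac (C_alpha a b f g s t u w) (C_beta c d h l p r).

End FormalPowerSeries.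

(* Permutations of {1, ..., n} are represented by permutations of
   {0, ..., n - 1}; the statistics only depend on the order of the indices. *)
Section Statistics.
Local Open Scope nat_scope.
Variables (n : nat) (sigma : 'S_n).
Let sigmaV : 'S_n := (sigma^-1)%g.

Definition exc := #|[set i : 'I_n | i < sigma i]|.
Definition fp := #|[set i : 'I_n | i == sigma i]|.
Definition aexc := #|[set i : 'I_n | i > sigma i]|.

Definition le := #|[set i : 'I_n | sigmaV i < i < sigma i]|.
Definition lae := #|[set i : 'I_n | (sigmaV i > i) && (i > sigma i)]|.

Definition ie := #|[set ij : 'I_n * 'I_n | let: (i, j) := ij in
  [&& i < j, j < sigma j & sigma j < sigma i]]|.
Definition ile := #|[set ij : 'I_n * 'I_n | let: (i, j) := ij in
  [&& i < j, j < sigma j, sigma j < sigma i & sigmaV j < j]]|.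

Definition nie := #|[set ij : 'I_n * 'I_n | let: (i, j) := ij in
  [&& i < j, j < sigma i & sigma i < sigma j]]|.
Definition nile := #|[set ij : 'I_n * 'I_n | let: (i, j) := ij in
  [&& i < j, j < sigma i, sigma i < sigma j & sigmaV j < j]]|.

Definition iae := #|[set ij : 'I_n * 'I_n | let: (i, j) := ij in
  [&& j > i, i > sigma i & sigma i > sigma j]]|.
Definition ilae := #|[set ij : 'I_n * 'I_n | let: (i, j) := ij in
  [&& j > i, i > sigma i, sigma i > sigma j & sigmaV i > i]]|.

Definition niae := #|[set ij : 'I_n * 'I_n | let: (i, j) := ij in
  [&& j > i, i > sigma j & sigma j > sigma i]]|.
Definition nilae := #|[set ij : 'I_n * 'I_n | let: (i, j) := ij in
  [&& j > i, i > sigma j, sigma j > sigma i & sigmaV i > i]]|.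

Definition iefp := #|[set ij : 'I_n * 'I_n | let: (i, j) := ij in
  [&& i < j, j == sigma j & j < sigma i]]|.

End Statistics.

(* Main.v *)
Require Import Defs.
From HB Require Import structures.
From mathcomp Require Import all_boot all_order all_algebra all_fingroup.
From mathcomp Require Import zify ring.
Import GRing.Theory.
Local Open Scope ring_scope.

Set Implicit Arguments.
Unset Strict Implicit.
Unset Printing Implicit Defensive.

(* Draw sigma as arcs from i to sigma(i) and read the positions from left to
   right: valleys are up steps, peaks are down steps and all the other positions
   are level steps of a Motzkin path whose height counts the open rising arcs,
   which are as many as the open falling arcs. Fix the path. If the starts of
   the rising arcs are treated from right to left, the end of each one is chosen
   among k free ends, and the crossings and nestings attributed to this start
   only depend on the rank of the choice, whence a factor [k]; dually for the
   falling arcs, treated from left to right. So the sum over sigma is a sum over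
   weighted Motzkin paths, which the continued fraction enumerates (Flajolet):
   if J_i is its i-th tail, z ^ j J_0 ... J_j satisfies the same recurrence as
   the series of the paths from height j down to 0. *)

(** * Weighted paths and continued fractions *)

Section SeriesProduct.
Variable R : comNzRingType.
Implicit Types F G K : fps R.

Definition fps_shift F : fps R := fun m => if m is m'.+1 then F m' else 0.

(** Cut down to polynomials, products of series inherit commutativity and associativity from the
    polynomial ring. *)
Lemma fps_mul_coef N F G m : (m < N)%N ->
  fps_mul F G m = (\poly_(i < N) F i * \poly_(i < N) G i)`_m.
Proof.
move=> lt_mN; rewrite coefM; apply: eq_bigr => i _.
by rewrite !coef_poly !ifT //; have := ltn_ord i; lia.
Qed.

Lemma fps_mulC F G : fps_mul F G =1 fps_mul G F.
Proof. by move=> m; rewrite !(fps_mul_coef _ _ (ltnSn m)) mulrC. Qed.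

Lemma fps_mulA F G K : fps_mul F (fps_mul G K) =1 fps_mul (fps_mul F G) K.
Proof.
move=> m; set P := fun F => \poly_(i < m.+1) F i.
transitivity ((P F * (P G * P K))`_m).
  rewrite coefM; apply: eq_bigr => i _; rewrite coef_poly ltn_ord.
  by rewrite (@fps_mul_coef m.+1) // ltnS leq_subr.
rewrite mulrA coefM; apply: eq_bigr => i _.
by rewrite (@fps_mul_coef m.+1) // coef_poly ltnS leq_subr.
Qed.

Lemma fps_mul1 F : fps_mul F (@fps_one R) =1 F.
Proof.
move=> m; rewrite fps_mulC /fps_mul big_ord_recl /= mul1r subn0.
by rewrite big1 ?addr0 // => i _; rewrite /fps_one mul0r.
Qed.

Lemma fps_mul_shift F G : fps_mul F (fps_shift G) =1 fps_shift (fps_mul F G).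
Proof.
case=> [|m]; first by rewrite /fps_mul big_ord1 mulr0.
rewrite [LHS]big_ord_recr /= subnn mulr0 addr0; apply: eq_bigr => i _ /=.
by rewrite subSn // -ltnS.
Qed.

Lemma fps_quadE (a b : R) F m :
  fps_quad a b F m
  = a * fps_shift (@fps_one R) m + b * fps_shift (fps_shift F) m.
Proof. by case: m => [|[|m]] /=; rewrite ?mulr0 ?mulr1 ?addr0 ?add0r. Qed.

Lemma fps_mul_quad (a b : R) F G m :
  fps_mul G (fps_quad a b F) m
  = a * fps_shift G m + b * fps_shift (fps_shift (fps_mul G F)) m.
Proof.
transitivity (a * fps_mul G (fps_shift (@fps_one R)) m
              + b * fps_mul G (fps_shift (fps_shift F)) m).
  rewrite /fps_mul !mulr_sumr -big_split; apply: eq_bigr => i _ /=.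
  by rewrite fps_quadE mulrDr !(mulrCA (G i)).
congr (_ * _ + _ * _); case: m => [|m]; rewrite fps_mul_shift //=.
  by rewrite fps_mul1.
by rewrite fps_mul_shift.
Qed.

End SeriesProduct.

(** * Tails of the fraction and paths down to height 0 *)

Section WeightedPaths.
Variables (R : comNzRingType) (alpha beta : nat -> R).

Definition jtail (k : nat) : fps R := fun m => jconv alpha beta m.+1 k m.

(** The tail J_k is the inverse of 1 - alpha_k z - beta_(k+1) z^2 J_(k+1). Convergents satisfy this
    relation by construction, and by stability they share with the tails all the coefficients
    involved. *)
Lemma jtail_rec k m :
  jtail k m = fps_one R m
    + fps_mul (jtail k) (fps_quad (alpha k) (beta k.+1) (jtail k.+1)) m.
Proof.
set Q := fps_quad (alpha k) (beta k.+1) (jconv alpha beta m k.+1).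
have /(_ m) := @fps_inv1BP _ Q erefl; rewrite /fps_mul.
under eq_bigr do rewrite mulrBl.
rewrite sumrB; have -> : \sum_(i < m.+1) fps_one R i * fps_inv1B Q (m - i)%N
    = fps_inv1B Q m.
  by rewrite -[LHS]/(fps_mul _ _ m) fps_mulC fps_mul1.
move/eqP; rewrite subr_eq => /eqP; rewrite -[jtail k m]/(fps_inv1B Q m) => ->.
congr (_ + _); rewrite -![\sum_(i < _) _]/(fps_mul _ _ m) fps_mulC.
apply: eq_fps_mul => [i le_im|[|[|i]] //= le_im].
  by rewrite /jtail (@jconv_stable _ _ _ i.+1 m.+1).
by rewrite /jtail (@jconv_stable _ _ _ i.+1 m) // ltnW.
Qed.

(* The generating series z ^ j J_0 ... J_j of paths from height j down to 0:
   J_i counts the excursions above i made before the final descent below i. *)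
Fixpoint jdescent (j : nat) : fps R :=
  if j is j'.+1 then fps_shift (fps_mul (jdescent j') (jtail j)) else jtail 0.

(** The last factor is expanded as J_j = 1 + J_j (alpha_j z + beta_(j+1) z^2 J_(j+1)); the three
    terms are the paths beginning with a down, a level and an up step. *)
Lemma jdescent_rec j m :
  jdescent j m.+1 = alpha j * jdescent j m
    + (if j is j'.+1 then jdescent j' m else 0) + beta j.+1 * jdescent j.+1 m.
Proof.
case: j => [|j] /=; first by rewrite jtail_rec fps_mul_quad add0r addr0.
have mulJ F : fps_mul F (jtail j.+1) m = F m +
    fps_mul (fps_mul F (jtail j.+1))
            (fps_quad (alpha j.+1) (beta j.+2) (jtail j.+2)) m.
  rewrite -fps_mulA -[X in X + _]fps_mul1 /fps_mul -big_split.
  by apply: eq_bigr => i _; rewrite /= -mulrDr jtail_rec.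
rewrite mulJ fps_mul_quad [LHS]addrCA -addrA; congr (_ + (_ + _ * _)).
case: m {mulJ} => [|m] //=.
rewrite [RHS]fps_mulC fps_mul_shift /fps_shift; case: m => // m.
by rewrite fps_mulC.
Qed.

Lemma jfrac_paths (up down : nat -> R) (V : nat -> nat -> R) :
    (forall j, beta j.+1 = up j * down j.+1) ->
    (forall j, V 0 j = (j == 0)%:R) ->
    (forall m j, V m.+1 j = up j * V m j.+1 + alpha j * V m j
       + (if j is j'.+1 then down j * V m j' else 0)) ->
  forall m, jfrac alpha beta m = V m 0.
Proof.
move=> betaE V0 Vrec m.
(* Each up step pairs with the first later return to its starting height, and the two together weigh
   a [beta]; the [j] unpaired down steps give the product. *)
suff VE j : V m j = (\prod_(i < j) down i.+1) * jdescent j m.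
  by rewrite VE big_ord0 mul1r.
elim: m j => [|m IHm] j.
  case: j => [|j]; rewrite V0 /= ?mulr0 // big_ord0 mul1r jtail_rec.
  by rewrite /fps_mul big_ord1 mulr0 addr0.
rewrite Vrec jdescent_rec !IHm betaE big_ord_recr /=.
case: j => [|j]; first by ring.
by rewrite IHm big_ord_recr /=; ring.
Qed.

End WeightedPaths.

(** * Choosing arcs one after the other *)

Section Brackets.
Variable R : comNzRingType.
Implicit Types x y : R.

Lemma qbracketS k x y : qbracket k.+1 x y = x ^+ k + y * qbracket k x y.
Proof.
rewrite /qbracket big_ord_recl expr0 mulr1 subn0 subn1 mulr_sumr.
congr (_ + _); apply: eq_bigr => i _ /=.
by rewrite exprS mulrCA; congr (_ * (_ ^+ _ * _)); rewrite /bump; lia.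
Qed.

Lemma qbracketC k x y : qbracket k x y = qbracket k y x.
Proof.
rewrite /qbracket (reindex_inj rev_ord_inj); apply: eq_bigr => i _ /=.
have := ltn_ord i => lt_ik; rewrite mulrC.
by congr (_ ^+ _ * _ ^+ _); lia.
Qed.

Lemma qbracket1 x y : qbracket 1 x y = 1.
Proof. by rewrite /qbracket big_ord1 mulr1. Qed.

(** The element of rank i, counted from 0, has i smaller and [size s - 1 - i] larger elements, which
    is the i-th term of the bracket. *)
Lemma sum_rank_qbracket x y (s : seq nat) : uniq s ->
  \sum_(v <- s) x ^+ count (fun v' => v < v')%N s * y ^+ count (fun v' => v' < v)%N s
  = qbracket (size s) x y.
Proof.
move=> uniq_s; have perm_s := permEl (perm_sort leq s).
rewrite -(perm_big _ perm_s) -(perm_size perm_s) /=.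
under eq_bigr do rewrite -!(seq.permP perm_s).
have: sorted ltn (sort leq s).
  by rewrite ltn_sorted_uniq_leq sort_uniq uniq_s sort_sorted //; apply: leq_total.
elim: (sort leq s) => [|v t IHt] /=; first by rewrite big_nil /qbracket big_ord0.
move=> path_t; have sorted_t := path_sorted path_t.
have lt_vt : {in t, forall v', v < v'}%N.
  by apply/allP; rewrite (order_path_min ltn_trans).
have gt_v : count (fun v' => v < v')%N t = size t.
  by apply/eqP; rewrite -all_count; apply/allP.
have lt_v : count (fun v' => v' < v)%N t = 0%N.
  by apply/eqP; rewrite -leqn0 leqNgt -has_count; apply/hasPn => v' /lt_vt; lia.
rewrite big_cons ltnn !add0n gt_v lt_v mulr1 qbracketS -IHt // mulr_sumr.
congr (_ + _).
rewrite [LHS]big_seq [RHS]big_seq; apply: eq_bigr => v' /lt_vt lt_vv'.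
by rewrite lt_vv' ltnNge (ltnW lt_vv') add0n exprS mulrCA.
Qed.

End Brackets.

Lemma sum_permutations_cons (V : nmodType) (T : eqType) (s : seq T) (k : nat)
    (F : seq T -> V) : uniq s -> size s = k.+1 ->
  \sum_(t <- permutations s) F t
  = \sum_(x <- s) \sum_(t <- permutations (rem x s)) F (x :: t).
Proof.
move=> uniq_s size_s.
rewrite (perm_big [seq x :: t | x <- s, t <- permutations (rem x s)]).
  by rewrite big_allpairs_dep.
apply: uniq_perm; first exact: permutations_uniq.
  apply: allpairs_uniq_dep => // [x _|]; first exact: permutations_uniq.
  by move=> [x t] [x' t'] _ _ /= [-> ->].
move=> t; rewrite mem_permutations; apply/idP/allpairsPdep => [perm_t|].
  case: t perm_t => [/perm_size|x t perm_t]; first by rewrite size_s.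
  have x_s : x \in s by rewrite -(perm_mem perm_t) mem_head.
  exists x, t; split=> //; rewrite mem_permutations -(perm_cons x).
  by rewrite (perm_trans perm_t) // perm_to_rem.
move=> [x [t' [x_s]]]; rewrite mem_permutations => perm_t' ->.
by rewrite perm_sym (perm_trans (perm_to_rem x_s)) // perm_cons perm_sym.
Qed.

(** A permutation is determined by the list of its images along [os], so summing over permutations
    is summing over successive choices of images. *)
Lemma sum_perm_permutations (V : nmodType) (n : nat) (os : seq 'I_n)
    (F : seq 'I_n -> V) : perm_eq os (enum 'I_n) ->
  \sum_(sigma : 'S_n) F (map sigma os) = \sum_(t <- permutations (enum 'I_n)) F t.
Proof.
move=> perm_os; pose m := [seq map sigma os | sigma : 'S_n].
have -> : \sum_(sigma : 'S_n) F (map sigma os) = \sum_(t <- m) F t.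
  by rewrite big_map big_enum.
have uniq_m : uniq m.
  rewrite map_inj_uniq ?enum_uniq // => sigma tau eq_st; apply/permP => i.
  have /eq_in_map := eq_st; apply.
  by rewrite (perm_mem perm_os) mem_enum.
have sub_m : {subset m <= permutations (enum 'I_n)}.
  move=> _ /mapP[sigma _ ->]; rewrite mem_permutations.
  apply: uniq_perm => [||i]; rewrite ?enum_uniq //.
    by rewrite map_inj_uniq ?(perm_uniq perm_os) ?enum_uniq //; apply: perm_inj.
  rewrite mem_enum; apply/mapP; exists (sigma^-1 i)%g; last by rewrite permKV.
  by rewrite (perm_mem perm_os) mem_enum.
apply: perm_big; apply: uniq_perm => //; first exact: permutations_uniq.
(* Both lists consist of n! distinct elements, so one inclusion suffices. *)
have [|//] := uniq_min_size uniq_m sub_m.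
by rewrite size_permutations ?enum_uniq // -cardE size_map -cardE card_Sn card_ord.
Qed.

(** * Sums over successive choices of ends *)

Section Greedy.
Variables (R : comNzRingType) (n : nat) (I : eqType).
Variables (allowed : I -> pred 'I_n) (x y : I -> R).

(** The list [vs'] holds the ends left to later starts, so the exponents count the allowed ends
    above and below [v] that are still free. *)
Fixpoint greedy_weight (os : seq I) (vs : seq 'I_n) : R :=
  match os, vs with
  | i :: os', v :: vs' =>
    (allowed i v)%:R * x i ^+ count (fun v' => allowed i v' && (v < v'))%N vs'
      * y i ^+ count (fun v' => allowed i v' && (v' < v))%N vs'
      * greedy_weight os' vs'
  | _, _ => 1
  end.

(** The factor of a choice ignores how the remaining ends will be distributed, hence it can leave
    the sum over the later choices. *)
Lemma perm_greedy_step i v vs vs' : perm_eq vs vs' ->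
  (allowed i v)%:R * x i ^+ count (fun v' => allowed i v' && (v < v'))%N vs
      * y i ^+ count (fun v' => allowed i v' && (v' < v))%N vs =
  (allowed i v)%:R * x i ^+ count (fun v' => allowed i v' && (v < v'))%N vs'
      * y i ^+ count (fun v' => allowed i v' && (v' < v))%N vs'.
Proof. by move=> /seq.permP eq_vs; rewrite !eq_vs. Qed.

Lemma sum_greedy_step i (s : seq 'I_n) : uniq s ->
  \sum_(v <- s | allowed i v)
     x i ^+ count (fun v' => allowed i v' && (v < v'))%N (rem v s)
     * y i ^+ count (fun v' => allowed i v' && (v' < v))%N (rem v s)
  = qbracket (count (allowed i) s) (x i) (y i).
Proof.
move=> uniq_s.
rewrite -size_filter -(size_map val) -sum_rank_qbracket; last first.
  by rewrite map_inj_uniq ?filter_uniq //; apply: val_inj.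
rewrite big_map big_filter big_seq_cond [RHS]big_seq_cond.
apply: eq_bigr => v /andP[v_s _]; rewrite !count_map !count_filter.
have /seq.permP eq_s := perm_to_rem v_s; rewrite !eq_s /= !ltnn !add0n.
by congr (_ ^+ _ * _ ^+ _); apply: eq_count => v' /=; rewrite andbC.
Qed.

Variables (same : rel I) (key : I -> nat).
Hypothesis same_allowed : forall i i', (key i < key i')%N -> same i i' ->
  subpred (allowed i) (allowed i').
Hypothesis diff_allowed : forall i i', (key i < key i')%N -> ~~ same i i' ->
  forall v, allowed i v -> ~~ allowed i' v.

(** As the sets of allowed ends are nested or disjoint, an earlier allowed choice takes exactly one
    end allowed for [i] if its start is related to [i] by [same], and none otherwise. The number of
    free ends thus does not depend on the choices made. *)
Lemma sum_greedy_weight (os : seq I) (s : seq 'I_n) :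
    pairwise (fun i i' => key i < key i')%N os -> uniq s -> size s = size os ->
  \sum_(t <- permutations s) greedy_weight os t
  = \prod_(i <- os) qbracket (count (allowed i) s
       - count (fun i' => (key i' < key i)%N && same i' i) os) (x i) (y i).
Proof.
elim: os s => [|i os IHos] s /=.
  by move=> _ _ /size0nil ->; rewrite /permutations /= big_seq1 big_nil.
move=> /andP[/allP lt_i pw_os] uniq_s size_s.
rewrite (sum_permutations_cons _ uniq_s size_s) big_cons ltnn add0n.
have -> : count (fun i' => (key i' < key i)%N && same i' i) os = 0%N.
  rewrite -[RHS](count_pred0 os); apply: eq_in_count => i' /lt_i /= lt_ii'.
  by rewrite ltnNge ltnW.
rewrite subn0.
rewrite -sum_greedy_step // mulr_suml [RHS]big_mkcond /=.
rewrite [LHS]big_seq [RHS]big_seq; apply: eq_bigr => v v_s.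
rewrite [LHS]big_seq.
under eq_bigr => t.
  rewrite mem_permutations => /(perm_greedy_step i v) ->; over.
rewrite -big_seq -mulr_sumr; case: ifP => [al_v|_]; last by rewrite !mul0r.
rewrite mul1r IHos ?rem_uniq ?size_rem ?size_s //; congr (_ * _).
rewrite [LHS]big_seq [RHS]big_seq; apply: eq_bigr => i' /lt_i lt_ii'.
have /seq.permP -> := perm_to_rem v_s; rewrite /= lt_ii' /=.
have [same_i|/diff_allowed-/(_ lt_ii' _ al_v)/negPf ->//] := boolP (same i i').
by rewrite (same_allowed lt_ii' same_i al_v) subnDl.
Qed.

(** Since [key] increases along [os], the starts treated later are those with a larger key; the
    exponents no longer refer to positions in the list. *)
Lemma greedy_weight_map (os : seq I) (sigma : I -> 'I_n) :
    pairwise (fun i i' => key i < key i')%N os ->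
  greedy_weight os (map sigma os) = \prod_(i <- os) ((allowed i (sigma i))%:R
    * x i ^+ count (fun i' => [&& key i < key i', allowed i (sigma i')
                                & sigma i < sigma i'])%N os
    * y i ^+ count (fun i' => [&& key i < key i', allowed i (sigma i')
                                & sigma i' < sigma i])%N os).
Proof.
elim: os => [|i os IHos] /=; first by rewrite big_nil.
move=> /andP[/allP lt_i pw_os]; rewrite big_cons IHos // !count_map ltnn !add0n.
congr (_ * _ ^+ _ * _ ^+ _ * _).
- by apply: eq_in_count => i' /lt_i /= ->.
- by apply: eq_in_count => i' /lt_i /= ->.
rewrite [LHS]big_seq [RHS]big_seq; apply: eq_bigr => i' /lt_i lt_ii'.
by rewrite [(key i' < key i)%N]ltnNge ltnW.
Qed.

End Greedy.

(** * Types of permutations *)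

(* The type of a position i of sigma: [None] for a fixed point, otherwise
   [Some (i < sigma i, sigma^-1 i < i)]. Thus [Some (true, false)] is a valley
   (an up step) and [Some (false, true)] a peak (a down step). *)
Definition step := option (bool * bool).

Definition outgoing (e : step) : option bool := omap fst e.
Definition incoming (e : step) : option bool := omap snd e.

Definition arc_dir (i v : nat) : option bool :=
  if (i < v)%N then Some true else if (v < i)%N then Some false else None.

Section PermutationType.
Variable n : nat.
Implicit Types (sigma : 'S_n) (T : {ffun 'I_n -> step}) (i v : 'I_n).

Definition ptype sigma : {ffun 'I_n -> step} :=
  [ffun i => if sigma i == i then None
             else Some (i < sigma i, (sigma^-1)%g i < i)%N].

(** The direction must suit both extremities. When [T i] is [None], the first condition leaves only
    [v = i]. *)
Definition allowed T i v : bool :=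
  (arc_dir i v == outgoing (T i)) && (incoming (T v) == outgoing (T i)).

Lemma outgoing_ptype sigma i : outgoing (ptype sigma i) = arc_dir i (sigma i).
Proof.
rewrite ffunE /arc_dir; case: eqVneq => [->|]; first by rewrite ltnn.
by rewrite -val_eqE /=; case: ltngtP.
Qed.

Lemma incoming_ptype sigma i : incoming (ptype sigma i) = arc_dir ((sigma^-1)%g i) i.
Proof.
rewrite ffunE /arc_dir; case: eqVneq => [fix_i|].
  have -> : (sigma^-1)%g i = i by rewrite -{1}fix_i permK.
  by rewrite ltnn.
rewrite -(inj_eq (@perm_inj _ sigma^-1)) permK eq_sym -val_eqE /=.
by case: ltngtP.
Qed.

Lemma step_eq (e e' : step) :
  outgoing e = outgoing e' -> incoming e = incoming e' -> e = e'.
Proof. by case: e e' => [[x y]|] [[x' y']|] //= [->] [->]. Qed.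

(** The fibres of [ptype] are cut out by conditions on single arcs, which lets a permutation of
    given type be built one arc at a time. *)
Lemma ptype_eq sigma T : (ptype sigma == T) = [forall i, allowed T i (sigma i)].
Proof.
apply/eqP/forallP => [<- i|allT].
  by rewrite /allowed outgoing_ptype incoming_ptype permK eqxx.
apply/ffunP => i; apply: step_eq.
  by rewrite outgoing_ptype; have /andP[/eqP] := allT i.
rewrite incoming_ptype; have := allT ((sigma^-1)%g i).
by rewrite /allowed permKV => /andP[/eqP -> /eqP].
Qed.

(* Rising arcs are treated from right to left, falling arcs from left to right:
   in this order each choice of an arc determines its own crossings and
   nestings. *)
Definition arc_order T i : nat :=
  match outgoing (T i) with
  | Some true => n - i
  | Some false => n + i
  | None => n + n + i
  end.

Definition same_side T i i' : bool :=
  (outgoing (T i) == outgoing (T i')) && (T i != None).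

(** Rising starts take values from 1 to n, falling ones from n to 2n - 1, fixed points from 2n on.
    The common value n can only come from position 0. *)
Lemma arc_order_inj T : injective (arc_order T).
Proof.
move=> i i'; rewrite /arc_order => eq_ii'; have [lt_i lt_i'] := (ltn_ord i, ltn_ord i').
have [//|neq] := eqVneq i i'.
have {}neq : val i <> val i' by move=> /val_inj/eqP; rewrite (negPf neq).
move: eq_ii' neq => /=.
have [i0|i0] := posnP i; have [i'0|i'0] := posnP i'; first by lia.
all: by case: (outgoing (T i)) => [[]|]; case: (outgoing (T i')) => [[]|]; lia.
Qed.

(** Of two starts on one side, the later one lies farther from the ends: more to the left for rising
    arcs, more to the right for falling ones. *)
Lemma same_side_allowed T i i' : (arc_order T i < arc_order T i')%N ->
  same_side T i i' -> subpred (allowed T i) (allowed T i').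
Proof.
move=> lt_ii' /andP[/eqP eq_out]; rewrite /allowed /arc_dir /= => Ti v.
move: lt_ii'; rewrite /arc_order -eq_out; have := ltn_ord i; have := ltn_ord i'.
case: (T i) Ti => [[[] y]|] //= _ lt_i lt_i' lt_ii'.
  by case: (ltngtP i v) => //= lt_iv; rewrite ifT //; lia.
by case: (ltngtP i v) => //= lt_iv; rewrite ifF ?ifT //; lia.
Qed.

(** An end receives arcs of one direction only, and a fixed point can only choose itself. *)
Lemma diff_side_allowed T i i' : (arc_order T i < arc_order T i')%N ->
  ~~ same_side T i i' -> forall v, allowed T i v -> ~~ allowed T i' v.
Proof.
move=> lt_ii'; rewrite /same_side negb_and => /orP[neq|/negPn/eqP Ti] v.
  rewrite /allowed => /andP[_ /eqP ->]; rewrite negb_and (negPf neq).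
  by rewrite orbT.
rewrite /allowed Ti /= => /andP[/eqP arc_iv /eqP ->].
rewrite negb_and orbC -implybE; apply/implyP => /eqP <-; apply: contraTN lt_ii'.
move: arc_iv; rewrite /arc_dir.
case: (ltngtP i v) => // /val_inj <- _.
by case: (ltngtP i' i) => // /val_inj ->; rewrite ltnn.
Qed.

Definition arc_seq T := sort (relpre (arc_order T) leq) (enum 'I_n).

Lemma perm_arc_seq T : perm_eq (arc_seq T) (enum 'I_n).
Proof. by rewrite perm_sort. Qed.

Lemma pairwise_arc_seq T :
  pairwise (fun i i' => arc_order T i < arc_order T i')%N (arc_seq T).
Proof.
rewrite -[pairwise _ _](pairwise_map (arc_order T) ltn).
rewrite -sorted_pairwise; last exact: ltn_trans.
rewrite ltn_sorted_uniq_leq map_inj_uniq ?sort_uniq ?enum_uniq; last exact: arc_order_inj.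
rewrite sorted_map /=; apply: sort_sorted => i i'; exact: leq_total.
Qed.

Lemma prod_arc_seq (R : comNzRingType) T (F : 'I_n -> R) :
  \prod_(i <- arc_seq T) F i = \prod_i F i.
Proof. by rewrite (perm_big _ (perm_arc_seq T)) big_enum. Qed.

Lemma count_arc_seq T (P : pred 'I_n) : count P (arc_seq T) = (\sum_i P i)%N.
Proof.
by rewrite (seq.permP (perm_arc_seq T)) -sum1_count big_mkcond big_enum.
Qed.

End PermutationType.

(** * Heights of the path encoded by a type *)

Section Heights.
Variable n : nat.
Implicit Types (k : nat) (T : 'I_n -> step) (i : 'I_n).

(* The two differences are taken on truncated naturals; they are the height
   after i and the height before i of the path from height k encoded by T when
   this path is [balanced] and stays nonnegative. *)
Definition arcs_over T i : nat :=
  (\sum_(v < n) ((i < v) && (incoming (T v) == Some true))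
   - \sum_(v < n) ((i < v) && (outgoing (T v) == Some true)))%N.

Definition arcs_under k T i : nat :=
  (k + \sum_(v < n) ((v < i) && (incoming (T v) == Some false))
   - \sum_(v < n) ((v < i) && (outgoing (T v) == Some false)))%N.

(** Each position changes the height by the number of rising arcs it starts minus the number it
    ends, so this says that the path from height [k] finishes at height 0. *)
Definition balanced k T : bool :=
  (k + \sum_i (outgoing (T i) == Some true)
   == \sum_i (incoming (T i) == Some true))%N.

End Heights.

Lemma balanced_ptype n (sigma : 'S_n) : balanced 0 (ptype sigma).
Proof.
rewrite /balanced add0n [X in _ == X](reindex_inj (@perm_inj _ sigma)) /=.
by apply/eqP/eq_bigr => i _; rewrite outgoing_ptype incoming_ptype permK.
Qed.

(** * Total weight of the permutations of a given type *)

Section TypeWeight.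
Variables (R : comNzRingType) (a b c d f g h l p r s t u w : R).

Definition step_weight (e : step) (over under : nat) : R :=
  match e with
  | None => u * w ^+ over
  | Some (true, true) => s * qbracket over a b
  | Some (true, false) => p * qbracket over c d
  | Some (false, true) => r * qbracket under h l
  | Some (false, false) => t * qbracket under f g
  end.

Definition step_factor (e : step) (over : nat) : R :=
  match e with
  | None => u * w ^+ over
  | Some (true, true) => s
  | Some (true, false) => p
  | Some (false, true) => r
  | Some (false, false) => t
  end.

(* An end left free beyond the chosen one will be a nesting for a rising arc,
   but a crossing for a falling arc. *)
Definition larger_weight (e : step) : R :=
  match e with
  | None => 1
  | Some (true, true) => a
  | Some (true, false) => c
  | Some (false, true) => l
  | Some (false, false) => g
  end.

Definition smaller_weight (e : step) : R :=
  match e with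
  | None => 1
  | Some (true, true) => b
  | Some (true, false) => d
  | Some (false, true) => h
  | Some (false, false) => f
  end.

Section Order.
Variable n : nat.
Implicit Types (T : {ffun 'I_n -> step}) (sigma : 'S_n) (i : 'I_n).

Definition larger_left T sigma i : nat :=
  (\sum_(i' < n) [&& arc_order T i < arc_order T i', allowed T i (sigma i')
             & sigma i < sigma i'])%N.

Definition smaller_left T sigma i : nat :=
  (\sum_(i' < n) [&& arc_order T i < arc_order T i', allowed T i (sigma i')
             & sigma i' < sigma i])%N.

(** A rising start may choose among the rising ends on its right, minus those taken by the rising
    starts on its right; dually on the left for a falling start. A fixed point has one choice. *)
Lemma step_weight_choices T i :
  step_factor (T i) (arcs_over T i) *
    qbracket (count (allowed T i) (enum 'I_n)
      - count (fun i' => (arc_order T i' < arc_order T i)%N && same_side T i' i)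
          (arc_seq T)) (larger_weight (T i)) (smaller_weight (T i))
  = step_weight (T i) (arcs_over T i) (arcs_under 0 T i).
Proof.
rewrite count_arc_seq -sum1_count big_mkcond big_enum /=.
set A := (\sum_i0 _)%N; set B := (\sum_i0 _)%N.
have lt_n (j : 'I_n) := ltn_ord j.
case Ti: (T i) => [[[] y]|].
- have -> : (A - B)%N = arcs_over T i.
    congr (_ - _)%N; apply: eq_bigr => j _.
      rewrite /allowed /arc_dir Ti; case: (ltngtP i j) => //=; case: (T j) => [[x []]|] //=.
    rewrite /same_side /arc_order Ti; case Tj: (T j) => [[[] y']|] //=; rewrite ?andbF //.
    by rewrite eqxx !andbT; have := lt_n i; have := lt_n j; lia.
  by case: y Ti.
- have -> : (A - B)%N = arcs_under 0 T i.
    rewrite /arcs_under add0n.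
    congr (_ - _)%N; apply: eq_bigr => j _.
      rewrite /allowed /arc_dir Ti; case: (ltngtP i j) => //=; case: (T j) => [[x []]|] //=.
    rewrite /same_side /arc_order Ti; case Tj: (T j) => [[[] y']|] //=; rewrite ?andbF //.
    by rewrite eqxx !andbT; have := lt_n i; have := lt_n j; lia.
  (* For falling arcs, the brackets of [step_weight] list the weight of smaller ends first. *)
  by case: y Ti => /= _; rewrite qbracketC.
have -> : A = 1%N.
  rewrite /A (bigD1 i) //= big1 ?addn0 => [|j neq_ji].
    by rewrite /allowed /arc_dir Ti ltnn.
  rewrite /allowed /arc_dir Ti; case: ltngtP => // /val_inj eq_ij.
  by rewrite eq_ij eqxx in neq_ji.
have -> : B = 0%N.
  by apply: big1 => j _; rewrite /same_side Ti; case: (T j) => [e|]; rewrite ?eqxx ?andbF.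
by rewrite qbracket1 mulr1.
Qed.

(** A permutation of type [T] is a sequence of allowed choices along [arc_seq T]. The step factors
    depend on [T] only, and the sum of the rest splits into one bracket per choice. *)
Lemma sum_ptype T :
  \sum_(sigma | ptype sigma == T)
     \prod_i (step_factor (T i) (arcs_over T i)
       * (larger_weight (T i) ^+ larger_left T sigma i
          * smaller_weight (T i) ^+ smaller_left T sigma i))
  = \prod_i step_weight (T i) (arcs_over T i) (arcs_under 0 T i).
Proof.
under [RHS]eq_bigr do rewrite -step_weight_choices.
rewrite big_split /= -(prod_arc_seq T (fun i => qbracket _ _ _)).
rewrite -(@sum_greedy_weight _ _ _ (allowed T) (fun i => larger_weight (T i))
  (fun i => smaller_weight (T i)) (same_side T) (arc_order T)); first last.
- by rewrite size_sort.
- exact: enum_uniq.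
- exact: pairwise_arc_seq.
- exact: diff_side_allowed.
- exact: same_side_allowed.
rewrite -(sum_perm_permutations _ (perm_arc_seq T)) mulr_sumr [LHS]big_mkcond.
apply: eq_bigr => sigma _.
rewrite (@greedy_weight_map _ _ _ _ _ _ _ _ sigma (pairwise_arc_seq T)) prod_arc_seq ptype_eq.
case: ifPn => [/forallP allT|].
  rewrite -big_split; apply: eq_bigr => i _ /=; rewrite allT mul1r.
  by rewrite !count_arc_seq.
(* A permutation of another type has an arc that is not allowed, so its greedy weight is 0. *)
rewrite negb_forall => /existsP[i /negPf alF].
by rewrite [X in _ * X](bigD1 i) //= alF !mul0r mulr0.
Qed.

End Order.
End TypeWeight.

(** * Sum over the types *)

Section PathSum.

Definition ffun_cons (X : Type) (n : nat) (e : X) (T : {ffun 'I_n -> X}) :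
    {ffun 'I_n.+1 -> X} :=
  [ffun i => if unlift ord0 i is Some j then T j else e].

Lemma ffun_cons0 X n (e : X) (T : {ffun 'I_n -> X}) : ffun_cons e T ord0 = e.
Proof. by rewrite ffunE unlift_none. Qed.

Lemma ffun_consS X n (e : X) (T : {ffun 'I_n -> X}) i :
  ffun_cons e T (lift ord0 i) = T i.
Proof. by rewrite ffunE liftK. Qed.

Lemma sum_ffun_cons (V : nmodType) (X : finType) (n : nat)
    (F : {ffun 'I_n.+1 -> X} -> V) :
  \sum_T F T = \sum_e \sum_T F (ffun_cons e T).
Proof.
rewrite pair_big /=; apply: reindex.
exists (fun T : {ffun 'I_n.+1 -> X} =>
  (T ord0, [ffun i : 'I_n => T (lift ord0 i)])) => [[e T] _ | T _] /=.
  congr pair; first exact: ffun_cons0.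
  by apply/ffunP => i; rewrite ffunE ffun_consS.
apply/ffunP => i; case: (unliftP ord0 i) => [j|] ->; last exact: ffun_cons0.
by rewrite ffun_consS ffunE.
Qed.

(** The terms are grouped as up, level and down steps, the order of the path recurrence. *)
Lemma sum_step (V : nmodType) (F : step -> V) :
  \sum_e F e = F (Some (true, false)) + (F None + F (Some (true, true))
                 + F (Some (false, false))) + F (Some (false, true)).
Proof.
rewrite (bigD1 (Some (true, false))) //= (bigD1 None) //=.
rewrite (bigD1 (Some (true, true))) //= (bigD1 (Some (false, false))) //=.
rewrite (bigD1 (Some (false, true))) //= big_pred0 => [|[[[] []]|]] //.
by rewrite addr0 !addrA.
Qed.

Section Cons.
Variables (n : nat) (e : step) (T : {ffun 'I_n -> step}).

Lemma arcs_over_cons0 : arcs_over (ffun_cons e T) ord0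
  = (\sum_i (incoming (T i) == Some true)
     - \sum_i (outgoing (T i) == Some true))%N.
Proof.
rewrite /arcs_over !big_ord_recl /= !add0n.
by congr (_ - _)%N; apply: eq_bigr => i _; rewrite ffun_consS.
Qed.

Lemma arcs_over_consS i :
  arcs_over (ffun_cons e T) (lift ord0 i) = arcs_over T i.
Proof.
rewrite /arcs_over !big_ord_recl /= !add0n.
by congr (_ - _)%N; apply: eq_bigr => j _; rewrite ffun_consS.
Qed.

Lemma arcs_under_cons0 k : arcs_under k (ffun_cons e T) ord0 = k.
Proof. by rewrite /arcs_under !big1 // addn0 subn0. Qed.

Lemma arcs_under_consS k i : arcs_under k (ffun_cons e T) (lift ord0 i)
  = (k + (incoming e == Some false)
       + \sum_(v < n) ((v < i) && (incoming (T v) == Some false))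
     - ((outgoing e == Some false)
        + \sum_(v < n) ((v < i) && (outgoing (T v) == Some false))))%N.
Proof.
rewrite /arcs_under !big_ord_recl /= ffun_cons0 addnA.
by congr (_ + _ - (_ + _))%N; apply: eq_bigr => j _; rewrite ffun_consS.
Qed.

Lemma balanced_cons k : balanced k (ffun_cons e T)
  = (k + ((outgoing e == Some true) + \sum_i (outgoing (T i) == Some true))
      == (incoming e == Some true) + \sum_i (incoming (T i) == Some true))%N.
Proof.
rewrite /balanced !big_ord_recl /= ffun_cons0.
by congr (_ + (_ + _) == _ + _)%N; apply: eq_bigr => j _; rewrite ffun_consS.
Qed.

End Cons.

Variables (R : comNzRingType) (a b c d f g h l p r s t u w : R).
Let weight := step_weight a b c d f g h l p r s t u w.

(** Paths that go below 0 are included but contribute 0: their first down step from height 0 carries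
    an empty bracket. *)
Definition path_sum (n k : nat) : R :=
  \sum_(T : {ffun 'I_n -> step} | balanced k T)
     \prod_i weight (T i) (arcs_over T i) (arcs_under k T i).

Lemma path_sum0 k : path_sum 0 k = (k == 0)%:R.
Proof.
rewrite /path_sum big_mkcond (big_pred1 [ffun=> None]) => [|T] /=.
  by rewrite /balanced !big_ord0 addn0; case: eqP.
by symmetry; apply/eqP/ffunP => -[].
Qed.

Lemma path_sumS n k : path_sum n.+1 k =
  p * qbracket k.+1 c d * path_sum n k.+1
  + C_alpha a b f g s t u w k * path_sum n k
  + (if k is k'.+1 then r * qbracket k h l * path_sum n k' else 0).
Proof.
rewrite /path_sum big_mkcond sum_ffun_cons sum_step /C_alpha !mulrDl.
(* The step [e] leads from height [k] to height [k']; for a type balanced from [k'], the ends minus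
   the starts of rising arcs number exactly [k']. *)
have stepE e k' (x : R) :
    (forall T : {ffun 'I_n -> step},
       balanced k (ffun_cons e T) = balanced k' T) ->
    (forall T i, arcs_under k (ffun_cons e T) (lift ord0 i)
                 = @arcs_under n k' T i) ->
    (forall T : {ffun 'I_n -> step}, balanced k' T ->
       weight e (\sum_i (incoming (T i) == Some true)
                 - \sum_i (outgoing (T i) == Some true))%N k = x) ->
  \sum_(T : {ffun 'I_n -> step})
     (if balanced k (ffun_cons e T) then
        \prod_i weight (ffun_cons e T i) (arcs_over (ffun_cons e T) i)
                       (arcs_under k (ffun_cons e T) i) else 0)
  = x * path_sum n k'.
  move=> balE underE xE; rewrite mulr_sumr [RHS]big_mkcond.
  apply: eq_bigr => T _; rewrite balE; case: ifP => // /xE <-.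
  rewrite big_ord_recl ffun_cons0 arcs_over_cons0 arcs_under_cons0.
  congr (_ * _); apply: eq_bigr => i _.
  by rewrite ffun_consS arcs_over_consS underE.
congr (_ + (_ + _ + _) + _).
- apply: stepE => [T|T i|T].
  + by rewrite balanced_cons /balanced [in RHS]addSnnS.
  + by rewrite arcs_under_consS /arcs_under /= addn1.
  + by move=> /eqP <-; rewrite addnK.
- apply: stepE => [T|T i|T].
  + by rewrite balanced_cons.
  + by rewrite arcs_under_consS addn0.
  + by move=> /eqP <-; rewrite addnK.
- apply: stepE => [T|T i|T].
  + by rewrite balanced_cons /balanced addnCA eqn_add2l.
  + by rewrite arcs_under_consS addn0.
  + by move=> /eqP <-; rewrite addnK.
- apply: stepE => [T|T i|T //].
  + by rewrite balanced_cons.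
  + by rewrite arcs_under_consS /arcs_under /= addn1 add1n addSn subSS.
case: k stepE => [_|k stepE].
  apply: big1 => T _; rewrite big_ord_recl ffun_cons0 arcs_under_cons0 /=.
  by rewrite /qbracket big_ord0 mulr0 mul0r if_same.
apply: stepE => [T|T i|T //].
- by rewrite balanced_cons /balanced /= add0n addSn add1n eqSS.
- by rewrite arcs_under_consS /arcs_under /= addn0 add1n addSn subSS.
Qed.

Lemma jfrac_path_sum m : C_series a b c d f g h l p r s t u w m = path_sum m 0.
Proof.
apply: (jfrac_paths (V := path_sum) (up := fun k => p * qbracket k.+1 c d)
  (down := fun k => r * qbracket k h l)) => [k||n k].
- by rewrite /C_beta; ring.
- exact: path_sum0.
- by rewrite path_sumS; case: k.
Qed.

End PathSum.

(** * The statistics *)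

Section Statistics.
Variables (n : nat) (sigma : 'S_n).
Implicit Types i j : 'I_n.
Local Open Scope nat_scope.

Lemma card_pairs (P : rel 'I_n) :
  #|[set ij : 'I_n * 'I_n | let: (i, j) := ij in P i j]| = \sum_i \sum_j P i j.
Proof.
rewrite -sum1_card big_mkcond pair_big; apply: eq_bigr => -[i j] _ /=.
by rewrite inE; case: (P i j).
Qed.

Lemma card_ords (P : pred 'I_n) : #|[set i | P i]| = \sum_i P i.
Proof.
by rewrite -sum1_card big_mkcond; apply: eq_bigr => i _; rewrite inE; case: (P i).
Qed.

(** The truncated differences in the exponents are exact, because each subtracted statistic keeps
    only some terms of the other. *)
Lemma sum_mask (P : pred 'I_n) (F : 'I_n -> nat) :
  \sum_i F i - \sum_i P i * F i = \sum_i ~~ P i * F i.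
Proof.
apply/eqP; rewrite -(eqn_add2l (\sum_i P i * F i)) subnKC.
  by rewrite -big_split; apply/eqP/eq_bigr => i _; case: (P i) => /=; lia.
by apply: leq_sum => i _; case: (P i) => /=; lia.
Qed.

(** Each pair of arcs is charged to the start treated first: the right one for rising arcs, the left
    one for falling arcs. A fixed point is charged with the arcs above it. *)
Definition nest_above j := \sum_(i < n) [&& i < j, j < sigma j & sigma j < sigma i].
Definition cross_above j := \sum_(i < n) [&& i < j, j < sigma i & sigma i < sigma j].
Definition nest_below i := \sum_(j < n) [&& i < j, sigma i < i & sigma j < sigma i].
Definition cross_below i := \sum_(j < n) [&& i < j, sigma j < i & sigma i < sigma j].
Definition fix_above j := \sum_(i < n) [&& i < j, j == sigma j & j < sigma i].

Lemma ieE : ie sigma = \sum_j nest_above j.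
Proof. by rewrite /ie card_pairs exchange_big. Qed.

Lemma ileE : ile sigma = \sum_(j < n) ((sigma^-1)%g j < j) * nest_above j.
Proof.
rewrite /ile card_pairs exchange_big; apply: eq_bigr => j _.
rewrite big_distrr; apply: eq_bigr => i _ /=.
by rewrite mulnb [in RHS]andbC -!andbA.
Qed.

Lemma nieE : nie sigma = \sum_j cross_above j.
Proof. by rewrite /nie card_pairs exchange_big. Qed.

Lemma nileE : nile sigma = \sum_(j < n) ((sigma^-1)%g j < j) * cross_above j.
Proof.
rewrite /nile card_pairs exchange_big; apply: eq_bigr => j _.
rewrite big_distrr; apply: eq_bigr => i _ /=.
by rewrite mulnb [in RHS]andbC -!andbA.
Qed.

Lemma iaeE : iae sigma = \sum_i nest_below i.
Proof. by rewrite /iae card_pairs. Qed.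

Lemma ilaeE : ilae sigma = \sum_(i < n) (i < (sigma^-1)%g i) * nest_below i.
Proof.
rewrite /ilae card_pairs; apply: eq_bigr => i _.
by rewrite big_distrr; apply: eq_bigr => j _; rewrite /= mulnb [in RHS]andbC -!andbA.
Qed.

Lemma niaeE : niae sigma = \sum_i cross_below i.
Proof. by rewrite /niae card_pairs. Qed.

Lemma nilaeE : nilae sigma = \sum_(i < n) (i < (sigma^-1)%g i) * cross_below i.
Proof.
rewrite /nilae card_pairs; apply: eq_bigr => i _.
by rewrite big_distrr; apply: eq_bigr => j _; rewrite /= mulnb [in RHS]andbC -!andbA.
Qed.

Lemma iefpE : iefp sigma = \sum_j fix_above j.
Proof. by rewrite /iefp card_pairs exchange_big. Qed.

Lemma leE : le sigma = \sum_(i < n) ((sigma^-1)%g i < i) * (i < sigma i).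
Proof. by rewrite /le card_ords; apply: eq_bigr => i _; rewrite mulnb. Qed.

Lemma laeE : lae sigma = \sum_(i < n) (i < (sigma^-1)%g i) * (sigma i < i).
Proof. by rewrite /lae card_ords; apply: eq_bigr => i _; rewrite mulnb. Qed.

(** The ends still free for [j] belong to rising arcs starting farther left: a larger end gives a
    nesting, a smaller one a crossing. *)
Lemma rise_left j : j < sigma j ->
  larger_left (ptype sigma) sigma j = nest_above j
  /\ smaller_left (ptype sigma) sigma j = cross_above j.
Proof.
move=> rise_j; split; apply: eq_bigr => i _; congr nat_of_bool;
  rewrite /allowed /arc_order incoming_ptype permK !outgoing_ptype /arc_dir rise_j;
  have := ltn_ord i; have := ltn_ord j;
  case: (ltngtP j (sigma i)); case: (ltngtP i (sigma i)) => //=; lia.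
Qed.

(** Falling starts treated later lie to the right, so a larger free end gives a crossing and a
    smaller one a nesting. *)
Lemma fall_left i : sigma i < i ->
  larger_left (ptype sigma) sigma i = cross_below i
  /\ smaller_left (ptype sigma) sigma i = nest_below i.
Proof.
move=> fall_i; have rise_i : (i < sigma i) = false by lia.
split; apply: eq_bigr => j _; congr nat_of_bool;
  rewrite /allowed /arc_order incoming_ptype permK !outgoing_ptype /arc_dir fall_i rise_i;
  have := ltn_ord i; have := ltn_ord j;
  case: (ltngtP i (sigma j)); case: (ltngtP j (sigma j)) => //=; lia.
Qed.

(** Among the rising arcs ending right of [j], removing those that start right of [j] leaves the
    arcs passing over it, since none starts at a fixed point. *)
Lemma arcs_over_fixed j : sigma j = j -> arcs_over (ptype sigma) j = fix_above j.
Proof.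
move=> fix_j; rewrite /arcs_over (reindex_inj (@perm_inj _ sigma)) /=.
set ends := \sum_i _; set starts := \sum_(v < n) _.
suff -> : ends = fix_above j + starts by rewrite addnK.
  rewrite -big_split; apply: eq_bigr => i _ /=.
  rewrite incoming_ptype permK outgoing_ptype fix_j eqxx /arc_dir.
  case: (ltngtP i j) => [lt_ij|lt_ji|/val_inj ->]; last by rewrite fix_j ltnn.
    by case: (ltngtP j (sigma i)); case: (ltngtP i (sigma i)) => //=; lia.
  by case: (ltngtP j (sigma i)); case: (ltngtP i (sigma i)) => //=; lia.
Qed.

Lemma rise_below j : j < sigma j ->
  [/\ nest_below j = 0, cross_below j = 0 & fix_above j = 0].
Proof.
by move=> rise_j; split; apply: big1 => i _; case: and3P => // -[]; rewrite -?val_eqE /=; lia.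
Qed.

Lemma fall_above i : sigma i < i ->
  [/\ nest_above i = 0, cross_above i = 0 & fix_above i = 0].
Proof.
by move=> fall_i; split; apply: big1 => j _; case: and3P => // -[]; rewrite -?val_eqE /=; lia.
Qed.

Lemma fixed_arcs i : sigma i = i ->
  [/\ nest_above i = 0, cross_above i = 0, nest_below i = 0 & cross_below i = 0].
Proof.
by move=> fix_i; split; apply: big1 => j _; case: and3P => // -[]; rewrite fix_i; lia.
Qed.

End Statistics.

(** * From permutation statistics to path weights *)

Section Main.
Variables (R : comNzRingType) (a b c d f g h l p r s t u w : R).

Definition position_weight n (sigma : 'S_n) (i : 'I_n) : R :=
  let T := ptype sigma in
  step_factor p r s t u w (T i) (arcs_over T i)
  * (larger_weight a c g l (T i) ^+ larger_left T sigma i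
     * smaller_weight b d f h (T i) ^+ smaller_left T sigma i).

Lemma sum_perm_path_sum n :
  \sum_(sigma : 'S_n) \prod_i position_weight sigma i
  = path_sum a b c d f g h l p r s t u w n 0.
Proof.
rewrite (partition_big (@ptype n) xpredT) //= /path_sum [RHS]big_mkcond.
apply: eq_bigr => T _; case: ifPn => [_|unbalT].
  by rewrite -sum_ptype; apply: eq_bigr => sigma /eqP <-.
(* An unbalanced type is the type of no permutation. *)
by rewrite big1 // => sigma /eqP eqT; rewrite -eqT balanced_ptype in unbalT.
Qed.

(** Every statistic is a sum over positions, so the monomial is a product over positions, compared
    factor by factor for rising, falling and fixed ones. *)
Lemma prod_position_weight n (sigma : 'S_n) :
  a ^+ ile sigma * b ^+ nile sigma *
  c ^+ (ie sigma - ile sigma) * d ^+ (nie sigma - nile sigma) *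
  f ^+ ilae sigma * g ^+ nilae sigma *
  h ^+ (iae sigma - ilae sigma) * l ^+ (niae sigma - nilae sigma) *
  p ^+ (exc sigma - le sigma) * r ^+ (aexc sigma - lae sigma) *
  s ^+ le sigma * t ^+ lae sigma *
  u ^+ fp sigma * w ^+ iefp sigma = \prod_i position_weight sigma i.
Proof.
rewrite ileE nileE ilaeE nilaeE ieE nieE iaeE niaeE leE laeE iefpE.
rewrite /exc /aexc /fp !card_ords !sum_mask !expr_sum -!big_split.
apply: eq_bigr => i _; rewrite /position_weight /=.
have Ti : ptype sigma i = if sigma i == i then None
                else Some (i < sigma i, (sigma^-1)%g i < i)%N by rewrite ffunE.
have simplE := (mul0n, mul1n, muln0, muln1, expr0, expr1, mul1r, mulr1).
case: (ltngtP i (sigma i)) => [rise_i|fall_i|/val_inj/esym fix_i].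
- have [-> -> ->] := rise_below rise_i; have [-> ->] := rise_left rise_i.
  have neq_i : (sigma i == i) = false by rewrite -val_eqE /= gtn_eqF.
  rewrite Ti (eq_sym i) neq_i rise_i !simplE.
  by case: (_ < i)%N; rewrite /= !simplE; ring.
- have [-> -> ->] := fall_above fall_i; have [-> ->] := fall_left fall_i.
  (* At a falling position the preimage differs from [i], so the condition in [lae], [ilae] and
     [nilae] is the negation of the incoming bit of the type. *)
  have -> : (i < (sigma^-1)%g i)%N = ~~ ((sigma^-1)%g i < i)%N.
    case: (ltngtP i ((sigma^-1)%g i)) => // /val_inj fix_i.
    by move: fall_i; rewrite {1}fix_i permKV ltnn.
  have neq_i : (sigma i == i) = false by rewrite -val_eqE /= ltn_eqF.
  have rise_i : (i < sigma i)%N = false by lia.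
  rewrite Ti (eq_sym i) neq_i rise_i !simplE.
  by case: (_ < i)%N; rewrite /= !simplE; ring.
have [-> -> -> ->] := fixed_arcs fix_i.
by rewrite arcs_over_fixed // Ti fix_i eqxx /= !expr1n !simplE.
Qed.

End Main.

Theorem theorem1 (R : comNzRingType) (a b c d f g h l p r s t u w : R) :
  C_series a b c d f g h l p r s t u w =1
  fun n : nat =>
    \sum_(sigma : 'S_n)
      a ^+ ile sigma * b ^+ nile sigma *
      c ^+ (ie sigma - ile sigma) * d ^+ (nie sigma - nile sigma) *
      f ^+ ilae sigma * g ^+ nilae sigma *
      h ^+ (iae sigma - ilae sigma) * l ^+ (niae sigma - nilae sigma) *
      p ^+ (exc sigma - le sigma) * r ^+ (aexc sigma - lae sigma) *
      s ^+ le sigma * t ^+ lae sigma *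
      u ^+ fp sigma * w ^+ iefp sigma.
Proof.
move=> n; rewrite jfrac_path_sum -sum_perm_path_sum; apply: eq_bigr => sigma _.
by rewrite prod_position_weight.
Qed.
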